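(* For every poset $P$ there is a monoid act $(X,M)$ such that $\leq_M$ is a partial order on $X$ and $P\cong P(X,M)$ as posets.
   Context: A semigroup (right) act $(X,S)$ consists of a set $X$, a semigroup $(S,\cdot)$, and an operation $X\times S\to X$, $(x,s)\mapsto xs$, such that $(xs)s'=x(s\cdot s')$ for all $x\in X$, $s,s'\in S$. It is a monoid act if $S$ is a monoid whose neutral element acts as the identity on $X$. Define $x\leq_S y :\iff \exists s\in S:\ xs=y$. If $\leq_S$ is a partial order on $X$, the poset $(X,\leq_S)$ is denoted $P(X,S)$ and called the Cayley poset of $(X,S)$. *)

(* Defs.v *)
From Stdlib Require Import Relation_Definitions.
From HB Require Import structures.
From mathcomp Require Import all_boot.

Set Implicit Arguments.
Unset Strict Implicit.
Unset Printing Implicit Defensive.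

(* MathComp's porderType is not used: it asks for a boolean-valued order and a
   choice operator on the carrier. *)
Record poset := Poset {
  poset_car :> Type;
  poset_le : relation poset_car;
  poset_leP : Relation_Definitions.order poset_car poset_le
}.

Definition poset_iso (P Q : poset) : Prop :=
  exists f : P -> Q,
    bijective f /\ forall x y : P, poset_le x y <-> poset_le (f x) (f y).

Definition semigroup_act (X : Type) (S : semigroupType) (op : X -> S -> X) :
    Prop :=
  forall (x : X) (s s' : S), op (op x s) s' = op x (s * s')%g.

Definition monoid_act (X : Type) (M : monoidType) (op : X -> M -> X) : Prop :=
  semigroup_act op /\ forall x : X, op x 1%g = x.

Definition cayley_le (X : Type) (S : semigroupType) (op : X -> S -> X) :
    relation X :=
  fun x y => exists s : S, op x s = y.

Definition cayley_poset (X : Type) (S : semigroupType) (op : X -> S -> X)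
    (h : Relation_Definitions.order X (cayley_le op)) : poset :=
  Poset h.

(* Main.v *)
Require Import Defs.
From Stdlib Require Import Relation_Definitions.
From HB Require Import structures.
From mathcomp Require Import all_boot.
From mathcomp Require Import boolp.

(** The extensive self-maps of [P], those [f] with [x <= f x] for all [x],
    contain the identity and are closed under composition, so they form a
    monoid, which acts on [P] by evaluation.  Reaching [y] from [x] by an
    extensive map forces [x <= y] ([cayley_le_poset_le]); conversely, if
    [x <= y], then the map that sends [x] to [y] and fixes every other point is
    extensive ([poset_le_cayley_le]).  So the relation of the act is the order
    of [P] itself, and the identity of [P] is the required isomorphism. *)

Section ExtensiveMaps.
Variable P : poset.

Lemma poset_le_refl (x : P) : poset_le x x.
Proof. by case: (poset_leP P) => + _ _; apply. Qed.

Lemma poset_le_trans (x y z : P) :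
  poset_le x y -> poset_le y z -> poset_le x z.
Proof. by case: (poset_leP P) => _ + _; apply. Qed.

(** Extensive self-maps of [P]; monotonicity is not required. *)
Record extensive : Type := Extensive {
  ext_fun : P -> P;
  ext_funP : forall x, poset_le x (ext_fun x)
}.

Lemma ext_inj (f g : extensive) : ext_fun f =1 ext_fun g -> f = g.
Proof.
case: f g => [f fP] [g gP] /= /funext fg.
by case: g / fg gP => gP; congr Extensive; apply: Prop_irrelevance.
Qed.

Definition ext_id : extensive := Extensive id poset_le_refl.

Lemma ext_comp_subproof (f g : extensive) (x : P) :
  poset_le x (ext_fun g (ext_fun f x)).
Proof. exact: poset_le_trans _ _ _ (ext_funP f x) (ext_funP g _). Qed.

(** Composition in diagrammatic order, [f] first, so that evaluation is a right
    act. *)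
Definition ext_comp (f g : extensive) : extensive :=
  Extensive (fun x => ext_fun g (ext_fun f x)) (ext_comp_subproof f g).

Lemma ext_compA : associative ext_comp.
Proof. by move=> f g h; apply: ext_inj. Qed.

Lemma ext_comp1f : left_id ext_id ext_comp.
Proof. by move=> f; apply: ext_inj. Qed.

Lemma ext_compf1 : right_id ext_id ext_comp.
Proof. by move=> f; apply: ext_inj. Qed.

HB.instance Definition _ := gen_eqMixin extensive.
HB.instance Definition _ := gen_choiceMixin extensive.
HB.instance Definition _ :=
  isMonoid.Build extensive ext_compA ext_comp1f ext_compf1.

(** The evaluation act of the monoid of extensive maps on [P]. *)
Definition ext_act (x : P) (f : extensive) : P := ext_fun f x.

Lemma ext_act_monoid_act : monoid_act ext_act.
Proof. by []. Qed.

Lemma cayley_le_poset_le (x y : P) : cayley_le ext_act x y -> poset_le x y.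
Proof. by move=> [f <-]; apply: ext_funP. Qed.

Lemma poset_le_cayley_le (x y : P) : poset_le x y -> cayley_le ext_act x y.
Proof.
move=> xy; pose f z := if pselect (z = x) then y else z.
have fP z : poset_le z (f z).
  by rewrite /f; case: pselect => [zx|_] /=; [rewrite zx | apply: poset_le_refl].
by exists (Extensive f fP); rewrite /ext_act /= /f; case: pselect.
Qed.

Lemma cayley_le_ext_act : cayley_le ext_act = @poset_le P.
Proof.
apply: funext => x; apply: funext => y; apply: propext.
by split; [exact: cayley_le_poset_le | exact: poset_le_cayley_le].
Qed.

End ExtensiveMaps.

Theorem theorem2p2 (P : poset) :
  exists (X : Type) (M : monoidType) (op : X -> M -> X),
    monoid_act op /\
    exists h : Relation_Definitions.order X (cayley_le op), poset_iso P (cayley_poset h).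
Proof.
exists P, (extensive P : monoidType), (ext_act P).
split; first exact: ext_act_monoid_act.
have h : Relation_Definitions.order P (cayley_le (ext_act P)).
  by rewrite cayley_le_ext_act; apply: poset_leP.
exists h, id; split; first by exists id.
by move=> x y /=; rewrite cayley_le_ext_act.
Qed.
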